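(* For $\alpha\in(0,1)$ put $L_{\alpha/2}:=\sqrt{|\log(\alpha/2)|}$ and let $\overline A_\alpha\ge0$ be defined by $\overline A_\alpha^2:=r+d\,(10L_{\alpha/2}+30L_{\alpha/2}^2)$. Then for all $A\in[\overline A_\alpha,\infty)$, $$\inf_{\varphi}\ \mathcal R\big(\varphi\,|\,\Theta_a^r,\Lambda_v^d,\theta^\circ,\,A\,[\rho_{a,v}(\varepsilon_\bullet)\vee\rho_{a,v}(\theta^\circ\sigma_\bullet)]\big)\ \le\ \alpha,$$ where the infimum is over all tests $\varphi$ and $\theta^\circ\sigma_\bullet:=(\theta_j^\circ\sigma_j)_{j\in\mathbb N}$.
   Context: Notation: $\mathbb N=\{1,2,\dots\}$; $x\vee y=\max(x,y)$; operations on sequences are componentwise; $\ell^2$ and $\ell^\infty$ are the spaces of square summable and of bounded real sequences indexed by $\mathbb N$. Model: $\varepsilon_\bullet=(\varepsilon_j)_{j\in\mathbb N}$ and $\sigma_\bullet=(\sigma_j)_{j\in\mathbb N}$ are known sequences of positive reals (noise levels). For $\theta\in\ell^2$, $\lambda\in\ell^\infty$, $P_{\theta,\lambda}$ is the law of $(Y,X)=((Y_j)_j,(X_j)_j)$ with all coordinates independent, $Y_j\sim N(\lambda_j\theta_j,\varepsilon_j^2)$ and $X_j\sim N(\lambda_j,\sigma_j^2)$ (second parameter = variance). A sequence $\theta^\circ\in\ell^2$ (null hypothesis) is fixed. Classes: $a=(a_j)_j$ and $v=(v_j)_j$ are strictly positive, monotonically nonincreasing sequences with $\sup_j a_j\le1$,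 $\sup_j v_j\le 1$; $r>0$, $d\ge1$; and $$\Theta_a^r:=\Big\{\theta\in\ell^2:\ \sum_{j>k}\theta_j^2\le r a_k^2\ \forall k\in\mathbb N\Big\},\qquad \Lambda_v^d:=\big\{\lambda\in\ell^\infty:\ \lambda_j^2\le d v_j^2\text{ and }v_j^2\le d\lambda_j^2\ \forall j\in\mathbb N\big\}.$$ Risk: a test is a measurable map $\varphi:\mathbb R^{\mathbb N}\times\mathbb R^{\mathbb N}\to\{0,1\}$ and, for $\rho\ge0$, $$\mathcal R(\varphi|\Theta_a^r,\Lambda_v^d,\theta^\circ,\rho):=\sup_{\lambda\in\Lambda_v^d}P_{\theta^\circ,\lambda}(\varphi=1)+\sup\big\{P_{\theta,\lambda}(\varphi=0):\ \theta-\theta^\circ\in\Theta_a^r,\ \|\theta-\theta^\circ\|_{\ell^2}\ge\rho,\ \lambda\in\Lambda_v^d\big\}.$$ Radius: for a real sequence $x_\bullet$, $$\rho_{a,v}(x_\bullet)^2:=\min_{k\in\mathbb N}\Big\{\Big(\sum_{j\le k}x_j^4/v_j^4\Big)^{1/2}\vee a_k^2\Big\},\quad \rho_{a,v}(x_\bullet)\ge0$$ (read as an infimum if the minimum is not attained). *)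

(* Defs.v *)
(* Sequences indexed by {1, 2, ...} are encoded as functions nat -> R with the
   index shifted by one: the value at n : nat is the entry of index n + 1.
   Accordingly "j <= k" still reads j <= k (so k.+1 summands, at least one),
   and "j > k" still reads k < j. *)
From HB Require Import structures.
From mathcomp Require Import all_boot all_order all_algebra finmap.
From mathcomp Require Import all_classical all_reals all_analysis.
Import Order.TTheory GRing.Theory Num.Theory.
Import numFieldNormedType.Exports.

Set Implicit Arguments.
Unset Strict Implicit.
Unset Printing Implicit Defensive.

Local Open Scope classical_set_scope.
Local Open Scope ring_scope.

(* R^N with the sigma-algebra generated by the coordinate maps. *)
Definition cylinders (R : realType) : set (set (nat -> R)) :=
  [set C | exists (j : nat) (B : set R),
     measurable B /\ C = [set x | B (x j)]].

Definition seqspace (R : realType) := g_sigma_algebraType (@cylinders R).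

(* The space of observations (Y, X), with the product sigma-algebra. *)
Notation obs R := (seqspace R * seqspace R)%type.

(* All coordinates of (Y, X) as one family: inl j is Y_j, inr j is X_j. *)
Definition obs_coord (R : realType) (i : nat + nat) (w : obs R) : R :=
  match i with inl j => w.1 j | inr j => w.2 j end.

Definition mutually_independent d (T : measurableType d) (R : realType)
    (P : probability T R) (I : choiceType) (Z : I -> T -> R) : Prop :=
  forall (J : {fset I}) (B : I -> set R), (forall i, measurable (B i)) ->
    P (\bigcap_(i in [set` J]) Z i @^-1` B i) =
    (\prod_(i <- J) P (Z i @^-1` B i))%E.

(* The second argument of normal_prob is the standard deviation. *)
Definition is_gaussian_law (R : realType) (eps sigma theta lambda : nat -> R)
    (Q : probability (obs R) R) : Prop :=
  [/\ mutually_independent Q (@obs_coord R),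
      forall (j : nat) (B : set R), measurable B ->
        Q (obs_coord (inl j) @^-1` B) = normal_prob (lambda j * theta j) (eps j) B &
      forall (j : nat) (B : set R), measurable B ->
        Q (obs_coord (inr j) @^-1` B) = normal_prob (lambda j) (sigma j) B].

Definition ell2 (R : realType) : set (nat -> R) :=
  [set x | (\sum_(0 <= j <oo) (x j ^+ 2)%:E < +oo)%E].

Definition ell2_norm (R : realType) (x : nat -> R) : R :=
  Num.sqrt (fine (\sum_(0 <= j <oo) (x j ^+ 2)%:E)%E).

Definition ellinfty (R : realType) : set (nat -> R) :=
  [set x | exists M : R, forall j, `|x j| <= M].

Definition Theta_class (R : realType) (a : nat -> R) (r : R) : set (nat -> R) :=
  [set theta | ell2 theta /\
     forall k, (\sum_(k.+1 <= j <oo) (theta j ^+ 2)%:E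
                <= (r * a k ^+ 2)%:E)%E].

Definition Lambda_class (R : realType) (v : nat -> R) (d : R) : set (nat -> R) :=
  [set lambda | ellinfty lambda /\
     forall j, lambda j ^+ 2 <= d * v j ^+ 2 /\
               v j ^+ 2 <= d * lambda j ^+ 2].

Definition tests (R : realType) : set (obs R -> bool) :=
  [set phi | measurable_fun setT phi].

(* P theta lambda stands for the law P_{theta,lambda}. Suprema are those of
   subsets of [0, 1]; in particular sup set0 = 0, so an empty alternative
   contributes no error. *)
Definition risk (R : realType)
    (P : (nat -> R) -> (nat -> R) -> probability (obs R) R)
    (phi : obs R -> bool) (Th La : set (nat -> R)) (theta0 : nat -> R)
    (rho : R) : R :=
  sup [set fine (P theta0 lambda (phi @^-1` [set true])) | lambda in La] +
  sup [set e : R | exists theta lambda : nat -> R,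
         [/\ Th (theta \- theta0), rho <= ell2_norm (theta \- theta0),
             La lambda & e = fine (P theta lambda (phi @^-1` [set false]))]].

Definition testing_radius (R : realType) (a v x : nat -> R) : R :=
  Num.sqrt (inf [set Num.max
                       (Num.sqrt (\sum_(0 <= j < k.+1) x j ^+ 4 / v j ^+ 4))
                       (a k ^+ 2) | k in [set: nat]]).

Definition quantile_term (R : realType) (alpha : R) : R :=
  Num.sqrt `|ln (alpha / 2)|.

Definition Abar (R : realType) (r d alpha : R) : R :=
  let L := quantile_term alpha in Num.sqrt (r + d * (10 * L + 30 * L ^+ 2)).

(* Main.v *)
(* With Z_j = Y_j - theta0_j X_j, which is Gaussian with mean
   lambda_j (theta_j - theta0_j) and variance
   w_j = eps_j^2 + theta0_j^2 sigma_j^2, reject when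
   S = sum_(j <= k) (Z_j^2 - w_j) / v_j^2 is large. Both errors are bounded by
   Chernoff's method from the explicit Laplace transform of a quadratic form in
   independent Gaussians, with W >= (sum_(j <= k) w_j^2 / v_j^4)^(1/2) as scale:
   under the null S exceeds 2 L W + 2 L^2 W with probability at most e^(-L^2),
   and under the alternative S falls below B - 2 L (W^2 + 2 W B)^(1/2), B its
   mean, with probability at most e^(-L^2), where e^(-L^2) = alpha / 2.
   The infimum defining the radius need not be attained, so k is chosen
   near-optimal; the constants 10 and 30 leave room for this because
   L > 1/5. *)
Require Import Defs.
From HB Require Import structures.
From mathcomp Require Import all_boot all_order all_algebra finmap.
From mathcomp Require Import all_classical all_reals all_analysis.
From mathcomp Require Import measurable_realfun ring lra.
Import Order.TTheory GRing.Theory Num.Theory.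
Import numFieldNormedType.Exports.

Set Implicit Arguments.
Unset Strict Implicit.
Unset Printing Implicit Defensive.

Local Open Scope classical_set_scope.
Local Open Scope ring_scope.

(** * Integration against a measure with a density *)

Section weighted_measure.
Context d (T : measurableType d) (R : realType).
Variables (mu : {measure set T -> \bar R}) (g : T -> R).
Hypotheses (mg : measurable_fun [set: T] g) (g0 : forall x, 0 <= g x).
Local Open Scope ereal_scope.

(* The proofs are arguments so that the measure structure can be attached. *)
Definition weighted (_ : measurable_fun [set: T] g)
    (_ : forall x, (0 <= g x)%R) (A : set T) : \bar R :=
  \int[mu]_(x in A) (g x)%:E.

Local Notation nu := (weighted mg g0).

Let weighted0 : nu set0 = 0.
Proof. by rewrite /weighted integral_set0. Qed.

Let weighted_ge0 A : 0 <= nu A.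
Proof. by apply: integral_ge0 => x _; rewrite lee_fin. Qed.

Let weighted_sigma_additive : semi_sigma_additive nu.
Proof.
move=> F mF tF mUF; rewrite /weighted ge0_integral_bigcup//; last 2 first.
- exact/measurable_EFinP/measurable_funTS.
- by move=> x _; rewrite lee_fin.
apply: is_cvg_ereal_nneg_natsum_cond => n _ _; exact: weighted_ge0.
Qed.

HB.instance Definition _ := isMeasure.Build _ _ _ nu
  weighted0 weighted_ge0 weighted_sigma_additive.

Import HBNNSimple.

Let integral_weighted_nnsfun (f : {nnsfun T >-> R}) :
  \int[nu]_x (f x)%:E = \int[mu]_x ((f x)%:E * (g x)%:E).
Proof.
have mgE : measurable_fun setT (EFin \o g) by exact/measurable_EFinP.
under [LHS]eq_integral do rewrite fimfunE -fsumEFin//.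
rewrite ge0_integral_fsum//; last 2 first.
- by move=> r; exact/measurable_EFinP/measurableT_comp.
- by move=> r z _; rewrite EFinM nnfun_muleindic_ge0.
under [RHS]eq_integral.
  move=> x _; rewrite fimfunE -fsumEFin// ge0_mule_fsuml; last first.
    by move=> r; rewrite EFinM nnfun_muleindic_ge0.
  over.
rewrite [RHS]ge0_integral_fsum//; last 2 first.
- move=> r; apply: emeasurable_funM => //.
  by apply/measurable_EFinP; exact: measurableT_comp.
- move=> r x _; apply: mule_ge0; last by rewrite lee_fin.
  by rewrite EFinM nnfun_muleindic_ge0.
apply: eq_fsbigr => r _.
rewrite integralZl_indic_nnsfun//= integral_indic// setIT.
(* A negative [r] has empty preimage under the nonnegative [f], so both sides vanish. *)
have [r0|r0] := leP 0%R r; last first.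
  rewrite preimage_nnfun0// measure0 mule0 integral0_eq// => x _.
  by rewrite indic0 mulr0 mul0e.
under eq_integral do rewrite EFinM -muleA.
rewrite ge0_integralZl//; last 2 first.
- apply: emeasurable_funM => //; exact/measurable_EFinP.
- by move=> x _; rewrite mule_ge0 ?lee_fin.
congr (_ * _); rewrite /weighted/= [LHS]integral_mkcond.
apply: eq_integral => x _; rewrite patchE indicE.
by case: ifPn => /=; rewrite ?mul1e ?mul0e.
Qed.

(** Both sides are limits along one increasing sequence of simple functions, for which the identity
    reduces to indicators. *)
Lemma ge0_integral_weighted (f : T -> \bar R) :
  measurable_fun [set: T] f -> (forall x, 0 <= f x) ->
  \int[nu]_x f x = \int[mu]_x (f x * (g x)%:E).
Proof.
move=> mf f0; pose f_ := nnsfun_approx measurableT mf.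
have mgE : measurable_fun setT (EFin \o g) by exact/measurable_EFinP.
have f_cvg x : (f_ n x)%:E @[n --> \oo] --> f x by exact: cvg_nnsfun_approx.
have f_nd x : nondecreasing_seq (fun n => (f_ n x)%:E).
  by move=> a b ab; rewrite lee_fin; exact/lefP/nd_nnsfun_approx.
transitivity (lim (\int[nu]_x (f_ n x)%:E @[n --> \oo])).
  rewrite -monotone_convergence//=.
  - by apply: eq_integral => x _; apply/esym/cvg_lim.
  - by move=> n; exact/measurable_EFinP.
  - by move=> n x _; rewrite lee_fin.
transitivity (lim (\int[mu]_x ((f_ n x)%:E * (g x)%:E) @[n --> \oo])).
  by apply: congr_lim; apply/funext => n /=; exact: integral_weighted_nnsfun.
rewrite -monotone_convergence//=.
- apply: eq_integral => x _; apply/cvg_lim => //.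
  by under eq_fun do rewrite muleC; rewrite muleC; apply: cvgeZl.
- move=> n; apply: emeasurable_funM => //; exact/measurable_EFinP.
- by move=> n x _; rewrite mule_ge0 ?lee_fin.
- by move=> x _ a b ab; rewrite lee_wpmul2r ?lee_fin// -lee_fin; exact: f_nd.
Qed.

End weighted_measure.

(** * Laplace transforms of squares of Gaussian variables *)

Section gaussian_quadratic_exponential.
Context {R : realType}.
Implicit Types (m s c al b x y eps sigma : R).

Lemma ge0_integral_normal_prob m s (f : R -> \bar R) :
  measurable_fun [set: R] f -> (forall x, 0 <= f x)%E ->
  (\int[normal_prob m s]_x f x =
   \int[lebesgue_measure]_x (f x * (normal_pdf m s x)%:E))%E.
Proof.
move=> mf f0.
rewrite -(ge0_integral_weighted lebesgue_measure (measurable_normal_pdf m s)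
  (normal_pdf_ge0 m s) mf f0).
by apply: eq_measure_integral => A mA _.
Qed.

Lemma measurable_expR_sqr c al b :
  measurable_fun [set: R] (fun x => expR (c * (al * x - b) ^+ 2)).
Proof.
apply: measurableT_comp => //; apply: measurable_funM => //.
apply: measurable_funX; apply: measurable_funB => //.
Qed.

(** Completing the square: the tilted Gaussian density is a constant times the Gaussian density of
    variance [s^2 / D]. Since the latter has mass one, the constant is the value of the integral. *)
Lemma normal_pdf_expR_sqr m s c al b x (D := 1 - 2 * c * al ^+ 2 * s ^+ 2) :
  0 < s -> 0 < D ->
  expR (c * (al * x - b) ^+ 2) * normal_pdf m s x =
  (Num.sqrt D)^-1 * expR (c * (al * m - b) ^+ 2 / D) *
  normal_pdf ((m - 2 * c * al * b * s ^+ 2) / D) (s / Num.sqrt D) x.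
Proof.
move=> s0 D0; have q0 : 0 < Num.sqrt D by rewrite sqrtr_gt0.
have q2 : Num.sqrt D ^+ 2 = D by rewrite sqr_sqrtr// ltW.
have s'0 : s / Num.sqrt D != 0 by rewrite gt_eqF// divr_gt0.
rewrite !normal_pdfE ?gt_eqF// ?divr_gt0//.
have -> : normal_peak (s / Num.sqrt D) = Num.sqrt D * normal_peak s.
  rewrite /normal_peak expr_div_n q2.
  have H (u : R) : s ^+ 2 / D * u *+ 2 = D^-1 * (s ^+ 2 * u *+ 2).
    by rewrite mulrnAr [in RHS]mulrC mulrAC.
  by rewrite H sqrtrM ?invr_ge0 ?ltW// sqrtrV ?ltW// invfM invrK.
rewrite mulrCA [RHS]mulrACA mulKf ?gt_eqF//; congr (_ * _).
rewrite /normal_fun expr_div_n q2 -!expRD; congr expR.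
have : D != 0 by rewrite gt_eqF.
rewrite /D => D'0; field.
by rewrite D'0 gt_eqF.
Qed.

Lemma integral_normal_expR_sqr m s c al b
    (D := 1 - 2 * c * al ^+ 2 * s ^+ 2) : 0 < s -> 0 < D ->
  (\int[normal_prob m s]_x (expR (c * (al * x - b) ^+ 2))%:E =
   ((Num.sqrt D)^-1 * expR (c * (al * m - b) ^+ 2 / D))%:E)%E.
Proof.
move=> s0 D0; rewrite ge0_integral_normal_prob; last 2 first.
- by apply/measurable_EFinP; exact: measurable_expR_sqr.
- by move=> x; rewrite lee_fin expR_ge0.
under eq_integral do rewrite -EFinM normal_pdf_expR_sqr// EFinM.
rewrite ge0_integralZl//; last 2 first.
- by apply/measurable_EFinP; exact: measurable_normal_pdf.
- by move=> x _; rewrite lee_fin normal_pdf_ge0.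
by rewrite integral_normal_pdf mule1.
Qed.

Lemma measurable_expR_sqr_diff c al :
  measurable_fun [set: R * R] (fun z => expR (c * (z.1 - al * z.2) ^+ 2)).
Proof.
apply: measurableT_comp => //; apply: measurable_funM => //.
apply: measurable_funX; apply: measurable_funB => //.
exact: measurable_funM.
Qed.

(** Instead of identifying the law of [z.1 - al * z.2], the one-dimensional formula is applied to
    [z.2] and then to [z.1]. The first integration leaves the exponential of a square with [c / D1]
    in place of [c], and [D] factors as [D1 * D2]. *)
Lemma integral_normalX_expR_sqr m1 eps m2 sigma c al
    (D := 1 - 2 * c * (eps ^+ 2 + al ^+ 2 * sigma ^+ 2)) :
  0 < eps -> 0 < sigma -> 0 < D ->
  (\int[normal_prob m1 eps \x normal_prob m2 sigma]_z
     (expR (c * (z.1 - al * z.2) ^+ 2))%:E =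
   ((Num.sqrt D)^-1 * expR (c * (m1 - al * m2) ^+ 2 / D))%:E)%E.
Proof.
move=> eps0 sigma0 D0.
pose D1 := 1 - 2 * c * al ^+ 2 * sigma ^+ 2.
have D1_gt0 : 0 < D1.
  (* For [c <= 0] already [D1 >= 1]; for [c > 0], [D1] exceeds [D]. *)
  have [c0|c0] := leP c 0.
    rewrite subr_gt0 (le_lt_trans _ ltr01)// -!mulrA pmulr_rle0//.
    by rewrite mulr_le0_ge0// mulrA mulr_ge0 ?sqr_ge0// -expr2 sqr_ge0.
  have -> : D1 = D + 2 * c * eps ^+ 2 by rewrite /D1 /D; ring.
  by rewrite addr_gt0// !mulr_gt0// exprn_gt0.
pose D2 := 1 - 2 * (c / D1) * 1 ^+ 2 * eps ^+ 2.
have DE : D = D1 * D2.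
  by rewrite /D /D2 /D1; field; rewrite gt_eqF.
have D2_gt0 : 0 < D2 by rewrite -(pmulr_rgt0 _ D1_gt0) -DE.
rewrite fubini_tonelli1/=; last 2 first.
- by apply/measurable_EFinP; exact: measurable_expR_sqr_diff.
- by move=> z; rewrite lee_fin expR_ge0.
rewrite /fubini_F/=.
under eq_integral.
  move=> y _.
  under eq_integral do rewrite -sqrrN opprB.
  rewrite integral_normal_expR_sqr// -/D1 EFinM.
  rewrite (_ : c * (al * m2 - y) ^+ 2 / D1 =
    c / D1 * (1 * y - al * m2) ^+ 2); last by field; rewrite gt_eqF.
  over.
rewrite ge0_integralZl//; last first.
  by apply/measurable_EFinP; exact: measurable_expR_sqr.
rewrite integral_normal_expR_sqr// -/D2 -EFinM mulrA; congr (_ * expR _)%:E.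
  by rewrite DE sqrtrM ?ltW// invfM.
by rewrite DE; field; rewrite !gt_eqF.
Qed.

End gaussian_quadratic_exponential.

(** * Expectations of products over independent blocks *)

Section independent_blocks.
Context d d1 d2 (T : measurableType d) (E1 : measurableType d1)
  (E2 : measurableType d2) (R : realType).
Variables (Q : probability T R) (Y : nat -> T -> E1) (X : nat -> T -> E2).
Hypotheses (mY : forall j, measurable_fun [set: T] (Y j))
  (mX : forall j, measurable_fun [set: T] (X j)).
Variables (p : nat -> probability E1 R) (q : nat -> probability E2 R).
Variable N : nat.
Hypothesis YX_indep : forall (A : nat -> set E1) (B : nat -> set E2),
  (forall j, measurable (A j)) -> (forall j, measurable (B j)) ->
  Q (\bigcap_(j in `I_N) (Y j @^-1` A j `&` X j @^-1` B j)) =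
  (\prod_(j < N) (p j (A j) * q j (B j)))%E.

Let YX j w := (Y j w, X j w).

Let mYX j : measurable_fun [set: T] (YX j).
Proof. exact: measurable_fun_pair. Qed.

Let integral_indic_rect j A B : measurable A -> measurable B ->
  (\int[p j \x q j]_z (\1_(A `*` B) z)%:E = p j A * q j B)%E.
Proof.
move=> mA mB; rewrite integral_indic//; last exact: measurableX.
by rewrite setIT/= product_measure1E.
Qed.

(* The rectangle indicators among the [h j] are replaced one at a time by
   arbitrary functions, by uniqueness of the product measure. *)
Let integral_prod_blocks_upto n (h : nat -> E1 * E2 -> R) : (n <= N)%N ->
  (forall j, measurable_fun [set: E1 * E2] (h j)) ->
  (forall j z, 0 <= h j z) ->
  (forall j, (j < N)%N -> \int[p j \x q j]_z (h j z)%:E < +oo)%E ->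
  (forall j, (n <= j < N)%N -> exists A B,
     [/\ measurable A, measurable B & h j = \1_(A `*` B)]) ->
  (\int[Q]_w (\prod_(j < N) h j (YX j w))%:E =
   \prod_(j < N) \int[p j \x q j]_z (h j z)%:E)%E.
Proof.
elim: n h => [|n IHn] h nN mh h0 hoo hind.
  (* Indices with [N <= j] receive empty sets, so that choice yields total families of measurable
     sets. *)
  have hind' j : exists A B, [/\ measurable A, measurable B &
      (j < N)%N -> h j = \1_(A `*` B)].
    have [jN|Nj] := boolP (j < N)%N; last by exists set0, set0.
    by have [A [B [mA mB hAB]]] := hind j jN; exists A, B.
  have [A HA] := choice hind'.
  have {HA}[B HAB] := choice HA.
  have mA j : measurable (A j) by have [] := HAB j.
  have mB j : measurable (B j) by have [] := HAB j.
  have hE (j : 'I_N) : h j = \1_(A j `*` B j) by have [_ _] := HAB j; apply.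
  transitivity (Q (\bigcap_(j in `I_N) (Y j @^-1` A j `&` X j @^-1` B j))).
    rewrite -[in RHS](setIT (\bigcap_(j in _) _)) -integral_indic//; last first.
      apply: bigcap_measurableType => j _; apply: measurableI.
        by rewrite -[X in measurable X]setTI; exact: mY.
      by rewrite -[X in measurable X]setTI; exact: mX.
    apply: eq_integral => w _; congr EFin; rewrite indicE.
    have [/set_mem wAB|wAB] := boolP (w \in _).
      apply: big1 => j _; rewrite hE indicE mem_set//.
      by have [] := wAB j (ltn_ord j).
    have : exists j : 'I_N, ~ (Y j @^-1` A j `&` X j @^-1` B j) w.
      apply: contrapT => /forallNP H; move/negP: wAB; apply.
      by apply/mem_set => j jN; exact: contrapT (H (Ordinal jN)).
    by move=> [j wj]; rewrite (bigD1 j)//= hE indicE memNset ?mul0r.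
  rewrite YX_indep//; apply: eq_bigr => j _.
  by rewrite hE integral_indic_rect.
pose n' := Ordinal nN.
pose g w := \prod_(j < N | j != n') h j (YX j w).
have g0 w : 0 <= g w by exact: prodr_ge0.
have mg : measurable_fun [set: T] g.
  have -> : g = fun w => \prod_(j < N) if j != n' then h j (YX j w) else 1.
    by apply/funext => w; rewrite /g big_mkcond.
  apply: measurable_prod => j _; case: (j != n') => //.
  exact: (measurableT_comp (mh j) (mYX j)).
pose k := (\prod_(j < N | j != n') \int[p j \x q j]_z (h j z)%:E)%E.
have int_h_ge0 j : (0 <= \int[p j \x q j]_z (h j z)%:E)%E.
  by apply: integral_ge0 => z _; rewrite lee_fin.
have k0 : (0 <= k)%E by exact: prode_ge0.
have kfin : k \is a fin_num.
  apply: (big_ind (fun x => x \is a fin_num)) => //.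
  - by move=> x y xfin yfin; rewrite fin_numM.
  - by move=> j _; rewrite ge0_fin_numE// hoo.
pose kn : {nonneg R} := NngNum (fine_ge0 k0).
(* [nu] is the image under block [n] of [Q] weighted by the other factors. Its value on a rectangle
   is the induction hypothesis with [h n] replaced by the indicator of that rectangle. *)
pose nu := pushforward (weighted Q mg g0) (YX n).
have nuE A B : measurable A -> measurable B ->
    nu (A `*` B) = (mscale kn (p n) A * q n B)%E.
  move=> mA mB.
  pose h1 j := if j == n then \1_(A `*` B) else h j.
  have h1n : h1 n = \1_(A `*` B) by rewrite /h1 eqxx.
  have := IHn h1 (ltnW nN); rewrite (bigD1 n')//= h1n.
  rewrite integral_indic_rect//.
  rewrite (eq_bigr (fun j : 'I_N => \int[p j \x q j]_z (h j z)%:E)%E); last first.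
    by move=> j jn'; rewrite /h1 ifN.
  rewrite -/k /mscale/= fineK// muleC muleA => <-.
  - rewrite /nu/pushforward/weighted integral_mkcond.
    apply: eq_integral => w _; rewrite patchE (bigD1 n')//= h1n indicE.
    rewrite (eq_bigr (fun j : 'I_N => h j (YX j w))); last first.
      by move=> j jn'; rewrite /h1 ifN.
    rewrite -/(g w) (_ : (w \in _) = (YX n w \in A `*` B))//.
    by case: ifPn => _; rewrite ?mul1r ?mul0r.
  - move=> j; rewrite /h1; case: ifPn => // _; apply: measurable_indic.
    exact: measurableX.
  - by move=> j z; rewrite /h1; case: ifPn.
  - move=> j jN; rewrite /h1; case: ifPn => [/eqP ->|_]; last exact: hoo.
    rewrite integral_indic_rect// lte_mul_pinfty// ?fin_num_measure//.
    by rewrite (le_lt_trans (probability_le1 _ _))// ltry.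
  - move=> j nj; rewrite /h1; case: ifPn => [_|jn]; first by exists A, B.
    by apply: hind; rewrite ltn_neqAle eq_sym jn.
transitivity (\int[nu]_z (h n z)%:E)%E.
  rewrite ge0_integral_pushforward//=; last 2 first.
  - exact/measurable_EFinP.
  - by move=> z _; rewrite lee_fin.
  rewrite preimage_setT ge0_integral_weighted//=; last 2 first.
  - by apply/measurable_EFinP; exact: measurableT_comp.
  - by move=> w; rewrite lee_fin.
  by apply: eq_integral => w _; rewrite (bigD1 n').
(* Agreement on rectangles determines [nu]. The constant first sits on one factor, so that the
   measure is literally a product, and is then moved outside. *)
rewrite (eq_measure_integral (mscale kn (p n) \x q n)%E); last first.
  move=> C mC _; apply/esym; apply: product_measure_unique => //.
rewrite (eq_measure_integral (mscale kn (p n \x q n)%E)); last first.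
  move=> C mC _; apply: product_measure_unique => // A B mA mB.
  rewrite /mscale/= -muleA; congr (_ * _)%E; exact: product_measure1E.
rewrite ge0_integral_mscale//=; last 2 first.
- exact/measurable_EFinP.
- by move=> z _; rewrite lee_fin.
by rewrite (bigD1 n')//= fineK// muleC.
Qed.

Lemma integral_prod_blocks (h : nat -> E1 * E2 -> R) :
  (forall j, measurable_fun [set: E1 * E2] (h j)) ->
  (forall j z, 0 <= h j z) ->
  (forall j, (j < N)%N -> \int[p j \x q j]_z (h j z)%:E < +oo)%E ->
  (\int[Q]_w (\prod_(j < N) h j (Y j w, X j w))%:E =
   \prod_(j < N) \int[p j \x q j]_z (h j z)%:E)%E.
Proof.
move=> mh h0 hoo; apply: (@integral_prod_blocks_upto N) => // j.
by case/andP => Nj; rewrite ltnNge Nj.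
Qed.

End independent_blocks.

(** * Finitely many observations under a Gaussian law *)

Section gaussian_law.
Context {R : realType}.

Lemma measurable_coord j : measurable_fun [set: seqspace R] (fun x => x j).
Proof.
move=> _ B mB; rewrite setTI; apply: sub_sigma_algebra.
by exists j, B.
Qed.

Lemma measurable_fst_coord j : measurable_fun [set: obs R] (fun w => w.1 j).
Proof. exact: (measurableT_comp (measurable_coord j) measurable_fst). Qed.

Lemma measurable_snd_coord j : measurable_fun [set: obs R] (fun w => w.2 j).
Proof. exact: (measurableT_comp (measurable_coord j) measurable_snd). Qed.

Lemma gaussian_law_rectangle (eps sigma theta lambda : nat -> R)
    (Q : probability (obs R) R) N (A B : nat -> set R) :
  is_gaussian_law eps sigma theta lambda Q ->
  (forall j, measurable (A j)) -> (forall j, measurable (B j)) ->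
  Q (\bigcap_(j in `I_N)
       ((fun w => w.1 j) @^-1` A j `&` (fun w => w.2 j) @^-1` B j)) =
  (\prod_(j < N) (normal_prob (lambda j * theta j) (eps j) (A j) *
                  normal_prob (lambda j) (sigma j) (B j)))%E.
Proof.
move=> [Qindep QY QX] mA mB.
(* Independence concerns a single family indexed by [nat + nat]. It is applied to both copies of the
   indices below [N], and the product is then regrouped into pairs. *)
pose s : seq (nat + nat) :=
  [seq inl j | j <- index_iota 0 N] ++ [seq inr j | j <- index_iota 0 N].
pose C (i : nat + nat) := match i with inl j => A j | inr j => B j end.
have mC i : measurable (C i) by case: i.
have us : uniq s.
  rewrite cat_uniq !map_inj_uniq ?iota_uniq ?andbT//=; last 2 first.
  - by move=> i j [].
  - by move=> i j [].
  by apply/hasPn => _ /mapP[j _ ->]; apply/negP => /mapP[].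
have := Qindep (seq_fset tt s) C mC.
rewrite (perm_big s); last first.
  by apply: uniq_perm => //; [exact: fset_uniq|exact: seq_fsetE].
rewrite big_cat !big_map/= => QE.
transitivity (Q (\bigcap_(i in [set` seq_fset tt s]) obs_coord i @^-1` C i)).
  congr (Q _); apply/seteqP; split => w /= wC.
    move=> i iJ; have : i \in s by rewrite -(seq_fsetE tt).
    rewrite mem_cat => /orP[]/mapP[j].
      by rewrite mem_index_iota => jN ->; have [] := wC j jN.
    by rewrite mem_index_iota => jN ->; have [] := wC j jN.
  move=> j jN; have js : j \in index_iota 0 N by rewrite mem_index_iota.
  have sJ i : i \in s -> i \in seq_fset tt s by rewrite seq_fsetE.
  split; [apply: (wC (inl j))|apply: (wC (inr j))]; apply: sJ.
    by rewrite mem_cat; apply/orP; left; exact: map_f.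
  by rewrite mem_cat; apply/orP; right; exact: map_f.
rewrite QE -big_split/= big_mkord; apply: eq_bigr => j _.
by rewrite -QY// -QX.
Qed.

Lemma gaussian_law_quadratic_mgf (eps sigma theta lambda : nat -> R)
    (Q : probability (obs R) R) N (al c : nat -> R)
    (D := fun j => 1 - 2 * c j * (eps j ^+ 2 + al j ^+ 2 * sigma j ^+ 2)) :
  (forall j, 0 < eps j) -> (forall j, 0 < sigma j) ->
  is_gaussian_law eps sigma theta lambda Q ->
  (forall j, (j < N)%N -> 0 < D j) ->
  (\int[Q]_w (expR (\sum_(j < N) c j * (w.1 j - al j * w.2 j) ^+ 2))%:E =
   (\prod_(j < N) ((Num.sqrt (D j))^-1 *
      expR (c j * (lambda j * theta j - al j * lambda j) ^+ 2 / D j)))%:E)%E.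
Proof.
move=> eps0 sigma0 lawQ D0.
pose h j (z : R * R) := expR (c j * (z.1 - al j * z.2) ^+ 2).
transitivity (\int[Q]_w (\prod_(j < N) h j (w.1 j, w.2 j))%:E)%E.
  by apply: eq_integral => w _; rewrite expR_sum.
pose E := g_sigma_algebraType R.-ocitv.-measurable.
rewrite (@integral_prod_blocks _ _ _ _ E E R Q (fun j w => w.1 j)
  (fun j w => w.2 j) measurable_fst_coord measurable_snd_coord
  (fun j => normal_prob (lambda j * theta j) (eps j))
  (fun j => normal_prob (lambda j) (sigma j)) N).
- rewrite -prodEFin; apply: eq_bigr => j _.
  by rewrite integral_normalX_expR_sqr//; exact: D0.
- by move=> A B mA mB; exact: gaussian_law_rectangle lawQ mA mB.
- by move=> j; exact: measurable_expR_sqr_diff.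
- by move=> j z; exact: expR_ge0.
- by move=> j jN; rewrite integral_normalX_expR_sqr ?ltry//; exact: D0.
Qed.

End gaussian_law.

(** * Elementary bounds for the exponential *)

Section exponential_inequalities.
Context {R : realType}.
Implicit Types x y u : R.

Lemma ge0_is_derive_le (f df : R -> R) :
  (forall x, is_derive x 1 f (df x)) -> (forall x, 0 <= x -> 0 <= df x) ->
  forall x, 0 <= x -> f 0 <= f x.
Proof.
move=> fdf df0 x x0; apply: (@ger0_derive1_ndecry _ f 0) => // [y|].
- rewrite in_itv/= andbT => /ltW y0; rewrite derive1E.
  by have [_ ->] := fdf y; exact: df0.
- apply: continuous_subspaceT => y; apply: differentiable_continuous.
  by apply/derivable1_diffP; have [] := fdf y.
Qed.

(** This is [y <= sinh y]: the difference of the two sides has derivative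
    [(exp y - 1)^2 / exp y]. *)
Lemma le_expR_sub_expRN y : 0 <= y -> 2 * y <= expR y - expR (- y).
Proof.
move=> y0; rewrite -subr_ge0.
pose f y := expR y - expR (- y) - 2 * y.
rewrite -[leRHS]/(f y) [leLHS](_ : _ = f 0); last first.
  by rewrite /f oppr0 expR0 subrr mulr0 subr0.
pose df y := expR y - - 1 * expR (- y) - 2 * 1.
apply: (@ge0_is_derive_le _ df) => // x.
  have -> : f = expR - (expR \o -%R) - 2 \*: (id : R -> R) by [].
  apply: is_derive_eq.
  by rewrite /df /GRing.scale/=; ring.
move=> x0; rewrite /df expRN; have := expR_gt0 x.
move: (expR x) => e e0.
have -> : e - -1 / e - 2 * 1 = (e - 1) ^+ 2 / e by field; rewrite gt_eqF.
by rewrite divr_ge0 ?sqr_ge0// ltW.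
Qed.

(** The quotient of the two sides, [(1 + u) exp (u^2 / 2 - u)], has derivative
    [u^2 exp (u^2 / 2 - u)] and equals 1 at 0. *)
Lemma expR_sub_sqr_le u : 0 <= u -> expR (u - u ^+ 2 / 2) <= 1 + u.
Proof.
move=> u0; pose f u := (1 + u) * expR (u ^+ 2 / 2 - u).
suff : f 0 <= f u.
  rewrite /f expr0n/= mul0r subr0 expR0 mulr1 addr0 -opprB expRN.
  by rewrite ler_pdivlMr ?expR_gt0// mul1r.
pose df u := u ^+ 2 * expR (u ^+ 2 / 2 - u).
apply: (@ge0_is_derive_le _ df) => // x.
  have -> : f = (cst 1 + id) * (expR \o (2^-1 \*: (id : R -> R) ^+ 2 - id)).
    apply/funext => y; rewrite /f; congr (_ * expR _); rewrite [y ^+ 2 / 2]mulrC.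
    by [].
  apply: is_derive_eq.
  rewrite /df /GRing.scale/= !fctE/= (_ : 2^-1 *: x ^+ 2 = x ^+ 2 / 2).
    by field.
  by rewrite mulrC.
by move=> _; rewrite mulr_ge0 ?sqr_ge0 ?expR_ge0.
Qed.

(** With [y = - ln (1 - u)] the left side is [exp (y / 2)], while the exponent on the right is
    [(exp y - exp (- y)) / 4], so [y <= sinh y] concludes. *)
Lemma invr_sqrt_1B_le u : 0 <= u < 1 ->
  (Num.sqrt (1 - u))^-1 <= expR (u / 2 + u ^+ 2 / (4 * (1 - u))).
Proof.
move=> /andP[u0 u1]; have s0 : 0 < 1 - u by rewrite subr_gt0.
pose y := - ln (1 - u).
have yE : expR (- y) = 1 - u by rewrite /y opprK lnK.
have y0 : 0 <= y by rewrite oppr_ge0 ln_le0// gerBl.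
have -> : (Num.sqrt (1 - u))^-1 = expR (y / 2).
  rewrite -yE (_ : - y = - (y / 2) + - (y / 2)); last by field.
  by rewrite expRD -expr2 sqrtr_sqr ger0_norm ?expR_ge0// expRN invrK.
rewrite ler_expR.
have eyE : expR y = (1 - u)^-1 by rewrite -yE expRN invrK.
have := le_expR_sub_expRN y0; rewrite yE eyE.
have -> : u / 2 + u ^+ 2 / (4 * (1 - u)) = ((1 - u)^-1 - (1 - u)) / 4.
  by field; rewrite gt_eqF.
by move=> H; lra.
Qed.

Lemma invr_sqrt_1D_le u : 0 <= u ->
  (Num.sqrt (1 + u))^-1 <= expR (- u / 2 + u ^+ 2 / 4).
Proof.
move=> u0; rewrite (_ : - u / 2 + _ = - ((u - u ^+ 2 / 2) / 2)); last by field.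
rewrite expRN lef_pV2 ?posrE ?expR_gt0 ?sqrtr_gt0 ?ltr_pwDl//.
rewrite -[leLHS]ger0_norm ?expR_ge0// -sqrtr_sqr ler_wsqrtr//.
rewrite expr2 -expRD -splitr; exact: expR_sub_sqr_le.
Qed.

End exponential_inequalities.

(** * Chernoff bounds for the centred quadratic statistic *)

Definition noise_var (R : realType) (eps sigma al : nat -> R) j : R :=
  eps j ^+ 2 + al j ^+ 2 * sigma j ^+ 2.

Definition quad_stat (R : realType) (eps sigma al g : nat -> R) N
    (w : obs R) : R :=
  \sum_(j < N) g j * ((w.1 j - al j * w.2 j) ^+ 2 - noise_var eps sigma al j).

(** The exponential of [f] dominates the indicator of [A]; this is the Markov step of Chernoff's
    method. *)
Lemma probability_le_integral_expR d (T : measurableType d) (R : realType)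
    (Q : probability T R) (A : set T) (f : T -> R) :
  measurable A -> measurable_fun [set: T] f ->
  (forall w, A w -> 0 <= f w) -> (Q A <= \int[Q]_w (expR (f w))%:E)%E.
Proof.
move=> mA mf f0; rewrite -[in leLHS](setIT A) -integral_indic//.
apply: ge0_le_integral => //.
- by apply/measurable_EFinP; exact: measurable_indic.
- by apply/measurable_EFinP; exact: measurableT_comp.
move=> w _; rewrite lee_fin indicE; have [/set_mem Aw|] := boolP (w \in A).
  by rewrite -[leLHS]expR0 ler_expR; exact: f0.
by rewrite expR_ge0.
Qed.

Section quadratic_statistic_tails.
Context {R : realType}.
Variables (eps sigma theta lambda al g : nat -> R) (N : nat).
Variable Q : probability (obs R) R.
Hypotheses (eps0 : forall j, 0 < eps j) (sigma0 : forall j, 0 < sigma j)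
  (g0 : forall j, 0 <= g j).
Hypothesis lawQ : is_gaussian_law eps sigma theta lambda Q.

Local Notation om := (noise_var eps sigma al).
Local Notation S := (quad_stat eps sigma al g N).
Local Notation mean j := (lambda j * theta j - al j * lambda j).

Lemma measurable_quad_stat : measurable_fun [set: obs R] S.
Proof.
apply: measurable_sum => j; apply: measurable_funM => //.
apply: measurable_funB => //; apply: measurable_funX.
apply: measurable_funB; first exact: measurable_fst_coord.
by apply: measurable_funM => //; exact: measurable_snd_coord.
Qed.

Lemma noise_var_ge0 j : 0 <= om j.
Proof. by rewrite addr_ge0 ?sqr_ge0// mulr_ge0// sqr_ge0. Qed.

Lemma quad_stat_mgf t : (forall j, (j < N)%N -> 0 < 1 - 2 * t * (g j * om j)) ->
  (\int[Q]_w (expR (t * S w))%:E =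
   (\prod_(j < N) (expR (- (t * (g j * om j))) *
     ((Num.sqrt (1 - 2 * t * (g j * om j)))^-1 *
      expR (t * (g j * mean j ^+ 2) / (1 - 2 * t * (g j * om j))))))%:E)%E.
Proof.
move=> D0; pose c j := t * g j.
have DE j : 1 - 2 * t * (g j * om j) = 1 - 2 * c j * om j.
  by rewrite /c; ring.
under eq_integral.
  move=> w _.
  rewrite (_ : t * S w = \sum_(j < N) (- (t * (g j * om j))) +
    \sum_(j < N) c j * (w.1 j - al j * w.2 j) ^+ 2); last first.
    rewrite -big_split/= /quad_stat mulr_sumr; apply: eq_bigr => j _.
    by rewrite /c; ring.
  rewrite expRD EFinM; over.
rewrite ge0_integralZl//; last first.
  apply/measurable_EFinP; apply: measurableT_comp => //.
  apply: measurable_sum => j; apply: measurable_funM => //.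
  apply: measurable_funX.
  apply: measurable_funB; first exact: measurable_fst_coord.
  by apply: measurable_funM => //; exact: measurable_snd_coord.
rewrite (gaussian_law_quadratic_mgf eps0 sigma0 lawQ); last first.
  by move=> j jN; rewrite -/(om j) -DE; exact: D0.
rewrite -EFinM expR_sum -big_split/=; congr EFin; apply: eq_bigr => j _.
by rewrite -/(om j) -DE /c !mulrA.
Qed.

Variable W : R.
Hypotheses (W0 : 0 < W) (WE : \sum_(j < N) (g j * om j) ^+ 2 <= W ^+ 2).

Let gom0 j : 0 <= g j * om j.
Proof. by rewrite mulr_ge0// noise_var_ge0. Qed.

Let gomW j : (j < N)%N -> g j * om j <= W.
Proof.
move=> jN; rewrite -(ler_pXn2r (ltn0Sn 1)) ?nnegrE ?gom0 ?(ltW W0)//.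
apply: le_trans WE; rewrite (bigD1 (Ordinal jN))//= lerDl.
by apply: sumr_ge0 => i _; exact: sqr_ge0.
Qed.

Lemma quad_stat_upper_tail (L : R) : (forall j, theta j = al j) -> 0 < L ->
  (Q [set w | 2 * L * W + 2 * L ^+ 2 * W <= S w]%R <= (expR (- L ^+ 2))%:E)%E.
Proof.
move=> thetaE L0; set tau := _ + _.
have q0 : 0 < 1 + 2 * L by lra.
(* This [t] minimises the Chernoff exponent [- t tau + t^2 W^2 / (1 - 2 t W)], and the minimum is
   exactly [- L^2]. *)
pose t := L / ((1 + 2 * L) * W).
have t0 : 0 < t by rewrite divr_gt0// mulr_gt0.
have tW : 1 - 2 * t * W = (1 + 2 * L)^-1.
  by rewrite /t; field; rewrite !gt_eqF.
have tj j : (j < N)%N -> 1 - 2 * t * W <= 1 - 2 * t * (g j * om j).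
  by move=> jN; rewrite lerD2l lerN2 ler_wpM2l ?gomW// mulr_ge0// ltW.
have D0 j : (j < N)%N -> 0 < 1 - 2 * t * (g j * om j).
  by move=> jN; apply: lt_le_trans (tj _ jN); rewrite tW invr_gt0.
apply: (@le_trans _ _ (\int[Q]_w (expR (- (t * tau) + t * S w))%:E)%E).
  apply: probability_le_integral_expR.
  - rewrite -[X in measurable X]setTI; apply: measurable_fun_le => //.
    exact: measurable_quad_stat.
  - apply: measurable_funD => //; apply: measurable_funM => //.
    exact: measurable_quad_stat.
  - by move=> w /= wS; rewrite addrC subr_ge0 ler_pM2l.
under eq_integral do rewrite expRD EFinM.
rewrite ge0_integralZl//; last first.
  apply/measurable_EFinP; apply: measurableT_comp => //.
  by apply: measurable_funM => //; exact: measurable_quad_stat.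
rewrite quad_stat_mgf// -EFinM lee_fin.
apply: (@le_trans _ _ (expR (- (t * tau)) *
    \prod_(j < N) expR (t ^+ 2 * (1 + 2 * L) * (g j * om j) ^+ 2))).
  rewrite ler_wpM2l ?expR_ge0//; apply: ler_prod => j _.
  rewrite !mulr_ge0 ?invr_ge0 ?sqrtr_ge0 ?expR_ge0//=.
  rewrite thetaE [al j * _]mulrC subrr expr0n/= !mulr0 mul0r expR0 mulr1.
  set u := 2 * t * (g j * om j).
  have u0 : 0 <= u by rewrite mulr_ge0 ?gom0// mulr_ge0// ltW.
  have u1 : u < 1 by rewrite -subr_gt0; exact: D0.
  apply: (@le_trans _ _ (expR (- (t * (g j * om j))) *
    expR (u / 2 + u ^+ 2 / (4 * (1 - u))))).
    by rewrite ler_wpM2l ?expR_ge0// invr_sqrt_1B_le// u0.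
  rewrite -expRD ler_expR.
  (* The centring of the statistic cancels the linear term [u / 2]. What remains is quadratic, and
     [(1 - u)^-1] is at most [1 + 2 L] because each [g_j om_j] is at most [W]. *)
  have -> : - (t * (g j * om j)) + (u / 2 + u ^+ 2 / (4 * (1 - u))) =
      t ^+ 2 * (g j * om j) ^+ 2 * (1 - u)^-1.
    by rewrite /u; field; rewrite gt_eqF//; exact: D0.
  rewrite mulrAC ler_wpM2r ?sqr_ge0// ler_wpM2l ?sqr_ge0//.
  rewrite -[leRHS]invrK -tW lef_pV2 ?posrE ?tj// ?D0//.
  by rewrite tW invr_gt0.
rewrite -expR_sum -mulr_sumr -expRD ler_expR.
apply: (@le_trans _ _ (- (t * tau) + t ^+ 2 * (1 + 2 * L) * W ^+ 2)).
  by rewrite lerD2l ler_wpM2l// mulr_ge0 ?sqr_ge0// ltW.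
rewrite le_eqVlt; apply/orP; left; apply/eqP.
by rewrite /t /tau; field; rewrite !gt_eqF.
Qed.

Lemma quad_stat_lower_tail (L : R) (B := \sum_(j < N) g j * mean j ^+ 2)
    (V := W ^+ 2 + 2 * W * B) : 0 < L ->
  (Q [set w | S w <= B - 2 * L * Num.sqrt V]%R <= (expR (- L ^+ 2))%:E)%E.
Proof.
move=> L0.
have gm0 j : 0 <= g j * mean j ^+ 2 by rewrite mulr_ge0 ?sqr_ge0.
have B0 : 0 <= B by apply: sumr_ge0.
have V0 : 0 < V by rewrite ltr_pwDl ?exprn_gt0// !mulr_ge0// ltW.
have q0 : 0 < Num.sqrt V by rewrite sqrtr_gt0.
have q2 : Num.sqrt V ^+ 2 = V by rewrite sqr_sqrtr// ltW.
(* The final exponent is at most [t^2 V - 2 t L sqrt V], minimised by this [t] with value [- L^2].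
   With the negative parameter [- t] all denominators are at least 1, so [t] is unrestricted. *)
pose t := L / Num.sqrt V; have t0 : 0 < t by rewrite divr_gt0.
set tau := B - _.
have DE j : 1 - 2 * - t * (g j * om j) = 1 + 2 * t * (g j * om j) by ring.
have u0 j : 0 <= 2 * t * (g j * om j).
  by rewrite mulr_ge0 ?gom0// mulr_ge0// ltW.
have D0 j : 0 < 1 + 2 * t * (g j * om j) by rewrite ltr_pwDl.
apply: (@le_trans _ _ (\int[Q]_w (expR (t * tau + - t * S w))%:E)%E).
  apply: probability_le_integral_expR.
  - rewrite -[X in measurable X]setTI; apply: measurable_fun_le => //.
    exact: measurable_quad_stat.
  - apply: measurable_funD => //; apply: measurable_funM => //.
    exact: measurable_quad_stat.
  - by move=> w /= wS; rewrite mulNr subr_ge0 ler_pM2l.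
under eq_integral do rewrite expRD EFinM.
rewrite ge0_integralZl//; last first.
  apply/measurable_EFinP; apply: measurableT_comp => //.
  by apply: measurable_funM => //; exact: measurable_quad_stat.
rewrite quad_stat_mgf; last by move=> j _; rewrite DE.
rewrite -EFinM lee_fin.
apply: (@le_trans _ _ (expR (t * tau) *
    \prod_(j < N) expR (t ^+ 2 * (g j * om j) ^+ 2 +
      (2 * t ^+ 2 * W - t) * (g j * mean j ^+ 2)))).
  rewrite ler_wpM2l ?expR_ge0//; apply: ler_prod => j _.
  rewrite !mulr_ge0 ?invr_ge0 ?sqrtr_ge0 ?expR_ge0//=.
  rewrite DE; set x := g j * om j; set y := g j * _.
  have x0 : 0 <= x := gom0 j.
  have xW : x <= W by exact: gomW.
  have y0 : 0 <= y := gm0 j.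
  have Dx : 0 < 1 + 2 * t * x := D0 j.
  apply: (@le_trans _ _ (expR (- (- t * x)) *
    (expR (- (2 * t * x) / 2 + (2 * t * x) ^+ 2 / 4) *
     expR (2 * t ^+ 2 * W * y - t * y)))).
    rewrite ler_wpM2l ?expR_ge0// ler_pM ?invr_ge0 ?sqrtr_ge0 ?expR_ge0//.
      by rewrite invr_sqrt_1D_le// u0.
    (* The noncentral exponent [- t y / (1 + 2 t x)] is replaced by [- t y + 2 t^2 W y], which is
       linear in [y] and hence sums to a multiple of [B]; this uses [x <= W]. *)
    rewrite ler_expR ler_pdivrMr//.
    have -> : (2 * t ^+ 2 * W * y - t * y) * (1 + 2 * t * x) =
      - t * y + 2 * t ^+ 2 * y * ((W - x) + 2 * t * x * W) by ring.
    rewrite lerDl; apply: mulr_ge0.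
      by rewrite mulr_ge0// mulr_ge0// sqr_ge0.
    rewrite addr_ge0 ?subr_ge0//.
    by rewrite mulr_ge0 ?(ltW W0)// mulr_ge0// mulr_ge0// ltW.
  rewrite -!expRD ler_expR le_eqVlt; apply/orP; left; apply/eqP.
  by field.
rewrite -expR_sum big_split/= -!mulr_sumr -/B -expRD ler_expR.
apply: (@le_trans _ _ (t * tau + (t ^+ 2 * W ^+ 2 + (2 * t ^+ 2 * W - t) * B))).
  by rewrite lerD2l lerD2r ler_wpM2l ?sqr_ge0.
have -> : t * tau + (t ^+ 2 * W ^+ 2 + (2 * t ^+ 2 * W - t) * B) =
    t ^+ 2 * V - 2 * (t * Num.sqrt V) * L by rewrite /tau /V; ring.
have tq : t * Num.sqrt V = L by rewrite divfK ?gt_eqF.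
have t2 : t ^+ 2 * V = L ^+ 2 by rewrite -tq [RHS]exprMn q2.
rewrite t2 tq.
by rewrite le_eqVlt; apply/orP; left; apply/eqP; ring.
Qed.

End quadratic_statistic_tails.

(** * Positivity of the radius and near-optimal truncation levels *)

Section testing_radius_bounds.
Context {R : realType}.
Implicit Types (a v x : nat -> R).

Let noise_norm x v k : R :=
  Num.sqrt (\sum_(0 <= j < k.+1) x j ^+ 4 / v j ^+ 4).

Let radius_set a v x : set R :=
  [set Num.max (noise_norm x v k) (a k ^+ 2) | k in [set: nat]].

Let radius_set_ge0 a v x : lbound (radius_set a v x) 0.
Proof. by move=> _ [k _ <-]; rewrite le_max sqrtr_ge0. Qed.

Let radius_set_neq0 a v x : radius_set a v x !=set0.
Proof. by eexists; exists 0%N. Qed.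

Lemma testing_radius_ge0 a v x : 0 <= testing_radius a v x.
Proof. exact: sqrtr_ge0. Qed.

Let testing_radius_sqr a v x : testing_radius a v x ^+ 2 = inf (radius_set a v x).
Proof.
rewrite sqr_sqrtr//; apply: lb_le_inf; first exact: radius_set_neq0.
exact: radius_set_ge0.
Qed.

Let term_ge0 x v j : 0 <= x j ^+ 4 / v j ^+ 4.
Proof. by rewrite divr_ge0// exprn_even_ge0. Qed.

(** Noise terms increase with the level, so the one at the lowest level is a positive lower bound
    for the infimum, attained or not. *)
Lemma testing_radius_gt0 a v x : (forall j, 0 < x j) -> (forall j, 0 < v j) ->
  0 < testing_radius a v x.
Proof.
move=> x0 v0; rewrite sqrtr_gt0.
apply: (@lt_le_trans _ _ (noise_norm x v 0)).
  by rewrite sqrtr_gt0 big_nat1 divr_gt0 ?exprn_gt0.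
apply: lb_le_inf => [|_ [k _ <-]]; first exact: radius_set_neq0.
rewrite le_max; apply/orP; left.
rewrite ler_sqrt; last by apply: sumr_ge0.
by rewrite [leRHS](big_cat_nat _ (n := 1))//= lerDl sumr_ge0.
Qed.

Lemma testing_radius_near a v x e : 0 < e -> exists k,
  \sum_(0 <= j < k.+1) x j ^+ 4 / v j ^+ 4 <= (testing_radius a v x ^+ 2 + e) ^+ 2
  /\ a k ^+ 2 <= testing_radius a v x ^+ 2 + e.
Proof.
move=> e0.
have hinf : has_inf (radius_set a v x).
  by split; [exact: radius_set_neq0|exists 0; exact: radius_set_ge0].
have [_ [k _ <-]] := inf_adherent e0 hinf.
rewrite -testing_radius_sqr gt_max => /andP[/ltW qk /ltW ak].
exists k; split => //.
rewrite -[leLHS]sqr_sqrtr ?sumr_ge0// ler_pXn2r ?nnegrE ?sqrtr_ge0//.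
by rewrite addr_ge0 ?sqr_ge0// ltW.
Qed.

(* The smaller of two near-optimal truncation levels is near-optimal for the
   noise terms of both radii, which increase with the level, and its bias term
   is controlled by the radius it comes from. *)
Lemma testing_radius_max_near a v x y e
    (rho := Num.max (testing_radius a v x) (testing_radius a v y)) :
  0 < e -> exists k,
  [/\ \sum_(0 <= j < k.+1) x j ^+ 4 / v j ^+ 4 <= (rho ^+ 2 + e) ^+ 2,
      \sum_(0 <= j < k.+1) y j ^+ 4 / v j ^+ 4 <= (rho ^+ 2 + e) ^+ 2 &
      a k ^+ 2 <= rho ^+ 2 + e].
Proof.
move=> e0.
have [k [xk ak]] := testing_radius_near a v x e0.
have [l [yl al]] := testing_radius_near a v y e0.
have le_rho z : testing_radius a v z <= rho ->
    testing_radius a v z ^+ 2 + e <= rho ^+ 2 + e.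
  move=> zrho; rewrite lerD2r ler_pXn2r ?nnegrE ?testing_radius_ge0//.
  exact: le_trans (testing_radius_ge0 _ _ _) zrho.
have xrho := le_rho x; have yrho := le_rho y.
have {}xrho : testing_radius a v x ^+ 2 + e <= rho ^+ 2 + e.
  by apply: xrho; rewrite le_max lexx.
have {}yrho : testing_radius a v y ^+ 2 + e <= rho ^+ 2 + e.
  by apply: yrho; rewrite le_max lexx orbT.
have sum_le z m n T : (m <= n)%N -> 0 <= T -> T <= rho ^+ 2 + e ->
    \sum_(0 <= j < n.+1) z j ^+ 4 / v j ^+ 4 <= T ^+ 2 ->
    \sum_(0 <= j < m.+1) z j ^+ 4 / v j ^+ 4 <= (rho ^+ 2 + e) ^+ 2.
  move=> mn T0 Trho zT; apply: (@le_trans _ _ (T ^+ 2)); last first.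
    by rewrite ler_pXn2r ?nnegrE// (le_trans T0).
  apply: le_trans zT; rewrite [leRHS](big_cat_nat _ (n := m.+1))//= lerDl.
  by apply: sumr_ge0.
have rad_ge0 z : 0 <= testing_radius a v z ^+ 2 + e.
  by rewrite addr_ge0 ?sqr_ge0// ltW.
exists (minn k l); split.
- exact: sum_le (geq_minl k l) (rad_ge0 x) xrho xk.
- exact: sum_le (geq_minr k l) (rad_ge0 y) yrho yl.
- by rewrite /minn; case: ifP => _; [exact: le_trans xrho|exact: le_trans yrho].
Qed.

End testing_radius_bounds.

(** * Energy of the signal below the truncation level *)

Section signal.
Context {R : realType}.
Implicit Types x y : nat -> R.

Lemma ell2D x y : ell2 x -> ell2 y -> ell2 (x \+ y).
Proof.
rewrite /ell2/= => x2 y2.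
apply: (@le_lt_trans _ _
  (\sum_(0 <= j <oo) (2%:E * (x j ^+ 2)%:E + 2%:E * (y j ^+ 2)%:E))%E).
  apply: lee_nneseries => j _; first by rewrite lee_fin sqr_ge0.
  rewrite -!EFinM -EFinD lee_fin -subr_ge0.
  by rewrite [leRHS](_ : _ = (x j - y j) ^+ 2) ?sqr_ge0//; ring.
rewrite nneseriesD; last 2 first.
- by move=> j _ _; rewrite -EFinM lee_fin mulr_ge0// sqr_ge0.
- by move=> j _ _; rewrite -EFinM lee_fin mulr_ge0// sqr_ge0.
rewrite !nneseriesZl; last 2 first.
- by move=> j _; rewrite lee_fin sqr_ge0.
- by move=> j _; rewrite lee_fin sqr_ge0.
by rewrite lte_add_pinfty// lte_mul_pinfty// ?lee_fin.
Qed.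

(** The total energy is at least [rho^2], and the entries after [k] carry at most [r a_k^2] of
    it. *)
Lemma Theta_class_head_ge (a : nat -> R) (r rho : R) x k :
  Theta_class a r x -> 0 <= rho -> rho <= ell2_norm x ->
  rho ^+ 2 - r * a k ^+ 2 <= \sum_(j < k.+1) x j ^+ 2.
Proof.
move=> [x2 xtail] rho0 rhox.
have x0 j : (0 <= (x j ^+ 2)%:E)%E by rewrite lee_fin sqr_ge0.
set s := (\sum_(0 <= j <oo) (x j ^+ 2)%:E)%E.
have s0 : (0 <= s)%E by apply: nneseries_ge0.
have sfin : s \is a fin_num by rewrite ge0_fin_numE.
have : rho ^+ 2 <= fine s.
  rewrite -[leRHS]sqr_sqrtr ?fine_ge0// ler_pXn2r ?nnegrE ?sqrtr_ge0//.
rewrite -lee_fin fineK// /s (nneseries_split 0 k.+1)// add0n => rhos.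
rewrite lerBlDr -lee_fin EFinD; apply: (le_trans rhos); apply: leeD => //.
by rewrite -sumEFin big_mkord.
Qed.

End signal.

(** * Numerical inequalities behind the constants *)

Section real_inequalities.
Context {R : realType}.

Lemma quantile_term_sqr (alpha : R) : 0 < alpha -> alpha < 1 ->
  expR (- quantile_term alpha ^+ 2) = alpha / 2.
Proof.
move=> a0 a1; rewrite /quantile_term sqr_sqrtr// ler0_norm; last first.
  by apply: ln_le0; lra.
by rewrite opprK lnK// posrE; lra.
Qed.

(** From [1 - L^2 <= exp (- L^2) = alpha / 2 < 1 / 2] even [L^2 > 1 / 2] follows; [1 / 5] is what
    [truncation_slack] asks for. *)
Lemma quantile_term_gt (alpha : R) : 0 < alpha -> alpha < 1 ->
  5^-1 < quantile_term alpha.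
Proof.
move=> a0 a1.
have L0 : 0 <= quantile_term alpha by exact: sqrtr_ge0.
have : 1 - quantile_term alpha ^+ 2 <= alpha / 2.
  by rewrite -quantile_term_sqr// expR_ge1Dx.
by move: (quantile_term alpha) L0 => L L0; nra.
Qed.

(** The root is at most [W + sqrt (2 W B)], and [sqrt (2 W B) <= B / (8 L) + 4 L W] by the
    arithmetic-geometric mean inequality. Multiplied by [2 L] this costs [B / 4], so
    [3 B / 4 >= 4 L W + 10 L^2 W] is needed, whence [16 / 3] and [40 / 3]. *)
Lemma lower_threshold_le (L W B : R) : 0 < L -> 0 < W -> 0 <= B ->
  16 / 3 * L * W + 40 / 3 * L ^+ 2 * W <= B ->
  2 * L * W + 2 * L ^+ 2 * W <= B - 2 * L * Num.sqrt (W ^+ 2 + 2 * W * B).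
Proof.
move=> L0 W0 B0 WB.
pose C := W + B / (8 * L) + 4 * L * W.
have b0 : 0 <= B / (8 * L) by rewrite divr_ge0// mulr_ge0// ltW.
have lw0 : 0 < L * W by rewrite mulr_gt0.
have C0 : 0 <= C by rewrite /C; lra.
have VC : Num.sqrt (W ^+ 2 + 2 * W * B) <= C.
  rewrite -[leRHS]ger0_norm// -sqrtr_sqr ler_wsqrtr// -subr_ge0.
  have -> : C ^+ 2 - (W ^+ 2 + 2 * W * B) =
      2 * W * (B / (8 * L) + 4 * L * W) + (B / (8 * L) - 4 * L * W) ^+ 2.
    by rewrite /C; field; rewrite gt_eqF.
  rewrite addr_ge0 ?sqr_ge0// mulr_ge0//; first by rewrite mulr_ge0// ltW.
  by lra.
have : 2 * L * Num.sqrt (W ^+ 2 + 2 * W * B) <= 2 * L * C.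
  by rewrite ler_wpM2l// mulr_ge0// ltW.
have -> : 2 * L * C = 2 * L * W + B / 4 + 8 * L ^+ 2 * W.
  by rewrite /C; field; rewrite gt_eqF.
by move=> H; lra.
Qed.

(** The condition [0 <= x] covers the empty set, whose [sup] is 0. *)
Lemma sup_le_ge0 (E : set R) x : 0 <= x -> ubound E x -> sup E <= x.
Proof.
move=> x0 Ex; have [->|/set0P E0] := eqVneq E set0; first by rewrite sup0.
exact: ge_sup.
Qed.

Lemma sup_nonneg (E : set R) : (forall x, E x -> 0 <= x) -> 0 <= sup E.
Proof.
move=> E0; have [hE|/sup_out ->//] := pselect (has_sup E).
have [x Ex] := hE.1; apply: (le_trans (E0 _ Ex)).
by apply: ub_le_sup => //; exact: hE.2.
Qed.

End real_inequalities.

(** Here [2 * (rho ^+ 2 + e)] is the scale [W] of the test. At [e = 0] the requirement is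
    [32 / 3 L + 80 / 3 L^2] against the available [10 L + 30 L^2]; the surplus [2 / 3 L (5 L - 1)]
    is positive and leaves room for some [e > 0]. *)
Lemma truncation_slack (R : realType) (r d L A rho : R) :
  0 < r -> 1 <= d -> 5^-1 < L -> 0 < rho ->
  r + d * (10 * L + 30 * L ^+ 2) <= A ^+ 2 ->
  exists2 e, 0 < e & forall bias B : R, bias <= rho ^+ 2 + e ->
    (A * rho) ^+ 2 - r * bias <= d * B ->
    16 / 3 * L * (2 * (rho ^+ 2 + e)) + 40 / 3 * L ^+ 2 * (2 * (rho ^+ 2 + e))
      <= B.
Proof.
move=> r0 d1 L5 rho0 A2; rewrite exprMn.
have : 0 < rho ^+ 2 by rewrite exprn_gt0.
move: (rho ^+ 2) => s s0 {rho rho0}.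
have L0 : 0 < L by lra.
have c0 : 0 < r + 32 / 3 * L + 80 / 3 * L ^+ 2.
  by rewrite !addr_gt0 ?mulr_gt0 ?exprn_gt0//; lra.
have gap0 : 0 < 10 / 3 * L ^+ 2 - 2 / 3 * L.
  rewrite (_ : _ - _ = 2 / 3 * L * (5 * L - 1)); last by field.
  by rewrite !mulr_gt0//; lra.
(* This [e] uses up the surplus exactly: its cost is [r e] in the bias and
   [(32 / 3 L + 80 / 3 L^2) e] in the scale. *)
pose e := (10 / 3 * L ^+ 2 - 2 / 3 * L) * s / (r + 32 / 3 * L + 80 / 3 * L ^+ 2).
have eE : e * (r + 32 / 3 * L + 80 / 3 * L ^+ 2) =
    (10 / 3 * L ^+ 2 - 2 / 3 * L) * s by rewrite divfK// gt_eqF.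
have e0 : 0 < e by rewrite !mulr_gt0// invr_gt0.
exists e => // bias B biasE dB.
have dB' : d * ((10 * L + 30 * L ^+ 2) * s) - r * e <= d * B.
  apply: le_trans dB.
  have : (r + d * (10 * L + 30 * L ^+ 2)) * s <= A ^+ 2 * s.
    by rewrite ler_wpM2r// ltW.
  have : r * bias <= r * (s + e) by rewrite ler_wpM2l// ltW.
  by move=> H1 H2; lra.
have d0 : 0 < d by lra.
have : (10 * L + 30 * L ^+ 2) * s - r * e <= B.
  rewrite -(ler_pM2l d0); apply: le_trans dB'.
  rewrite mulrBr lerD2l lerN2 ler_peMl// mulr_ge0// ltW//.
by move: eE => /eqP; rewrite eq_sym => /eqP eE' H; lra.
Qed.

(** * The test and its two errors *)

Theorem theorem2p4 (R : realType)
  (eps sigma : nat -> R)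
  (eps_gt0 : forall j, 0 < eps j) (sigma_gt0 : forall j, 0 < sigma j)
  (P : (nat -> R) -> (nat -> R) -> probability (obs R) R)
  (P_law : forall theta lambda : nat -> R, ell2 theta -> ellinfty lambda ->
     is_gaussian_law eps sigma theta lambda (P theta lambda))
  (theta0 : nat -> R) (theta0_ell2 : ell2 theta0)
  (a v : nat -> R)
  (a_gt0 : forall j, 0 < a j) (a_noninc : nonincreasing_seq a)
  (a_le1 : forall j, a j <= 1)
  (v_gt0 : forall j, 0 < v j) (v_noninc : nonincreasing_seq v)
  (v_le1 : forall j, v j <= 1)
  (r d : R) (r_gt0 : 0 < r) (d_ge1 : 1 <= d)
  (alpha : R) (alpha_gt0 : 0 < alpha) (alpha_lt1 : alpha < 1)
  (A : R) (A_ge : Abar r d alpha <= A) :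
  inf [set risk P phi (Theta_class a r) (Lambda_class v d) theta0
             (A * Num.max (testing_radius a v eps)
                          (testing_radius a v (fun j => theta0 j * sigma j)))
      | phi in tests (R := R)] <= alpha.
Proof.
set rho := Num.max _ _; set L := quantile_term alpha.
have L5 : 5^-1 < L by exact: quantile_term_gt.
have L0 : 0 < L by lra.
have d0 : 0 < d by lra.
(* The radius at [eps] is already positive, whereas [theta0] may vanish. *)
have rho0 : 0 < rho by rewrite lt_max testing_radius_gt0.
have Abar0 : 0 <= r + d * (10 * L + 30 * L ^+ 2).
  rewrite addr_ge0 ?(ltW r_gt0)// mulr_ge0 ?(ltW d0)//.
  by rewrite addr_ge0 ?mulr_ge0 ?sqr_ge0 ?(ltW L0).
have A0 : 0 <= A by apply: le_trans A_ge; exact: sqrtr_ge0.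
have A2 : r + d * (10 * L + 30 * L ^+ 2) <= A ^+ 2.
  rewrite -[leLHS]sqr_sqrtr// ler_pXn2r ?nnegrE ?sqrtr_ge0//.
have [e e0 slack] := truncation_slack r_gt0 d_ge1 L5 rho0 A2.
have [k [epsk thetak ak]] :=
  testing_radius_max_near a v eps (fun j => theta0 j * sigma j) e0.
rewrite -/rho big_mkord in epsk; rewrite -/rho big_mkord in thetak.
rewrite -/rho in ak.
pose g j := (v j ^+ 2)^-1.
have g0 j : 0 <= g j by rewrite invr_ge0 sqr_ge0.
(* The bound [(x + y)^2 <= 2 x^2 + 2 y^2] separates the two noise sources. Each of the two sums is
   at most [(rho^2 + e)^2], which gives [4 (rho^2 + e)^2 = W^2]. *)
pose W := 2 * (rho ^+ 2 + e).
have W0 : 0 < W by rewrite mulr_gt0// addr_gt0// exprn_gt0.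
have WE : \sum_(j < k.+1) (g j * noise_var eps sigma theta0 j) ^+ 2 <= W ^+ 2.
  apply: (@le_trans _ _ (\sum_(j < k.+1) (2 * (eps j ^+ 4 / v j ^+ 4) +
      2 * ((theta0 j * sigma j) ^+ 4 / v j ^+ 4)))).
    apply: ler_sum => j _; rewrite -subr_ge0.
    rewrite [leRHS](_ : _ =
      (g j * (eps j ^+ 2 - theta0 j ^+ 2 * sigma j ^+ 2)) ^+ 2) ?sqr_ge0//.
    by rewrite /g /noise_var; field; rewrite gt_eqF.
  rewrite big_split/= -!mulr_sumr.
  rewrite /W; lra.
pose tau := 2 * L * W + 2 * L ^+ 2 * W.
pose S := quad_stat eps sigma theta0 g k.+1.
pose phi (w : obs R) := tau <= S w.
have mS : measurable_fun [set: obs R] S by exact: measurable_quad_stat.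
have phi_test : tests phi by exact: measurable_fun_ler.
have prob_ge0 th la (X : set (obs R)) : 0 <= fine (P th la X).
  by rewrite fine_ge0.
have alpha2_ge0 : 0 <= alpha / 2 by lra.
have fine_le th la (X : set (obs R)) :
    (P th la X <= (expR (- L ^+ 2))%:E)%E -> fine (P th la X) <= alpha / 2.
  move=> PX; rewrite -(quantile_term_sqr alpha_gt0 alpha_lt1) -lee_fin fineK//.
  by rewrite ge0_fin_numE// (le_lt_trans PX)// ltry.
apply: (@le_trans _ _ (risk P phi (Theta_class a r) (Lambda_class v d) theta0
    (A * rho))).
  apply: ge_inf; last by exists phi.
  (* The infimum is at most a given member only if the set of risks is bounded below; 0 is such a
     bound. *)
  exists 0 => _ [psi _ <-]; apply: addr_ge0; apply: sup_nonneg.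
    by move=> _ [la _ <-].
  by move=> _ [th [la [_ _ _ ->]]].
rewrite (splitr alpha); apply: lerD; apply: sup_le_ge0 => //.
  move=> _ [la [la_inf _] <-]; apply: fine_le.
  exact: (quad_stat_upper_tail eps_gt0 sigma_gt0 g0 (P_law _ _ theta0_ell2 la_inf)
    W0 WE (fun=> erefl) L0).
move=> _ [th [la [thTh rho_th [la_inf la_v] ->]]]; apply: fine_le.
(* [P_law] asks for [th] itself in [ell2], whereas the alternative constrains its difference from
   [theta0]. *)
have th_ell2 : ell2 th.
  rewrite (_ : th = (th \- theta0) \+ theta0); last first.
    by apply/funext => j /=; rewrite subrK.
  by apply: ell2D => //; have [] := thTh.
set B := \sum_(j < k.+1) g j * (la j * th j - theta0 j * la j) ^+ 2.
have head := Theta_class_head_ge k thTh (mulr_ge0 A0 (ltW rho0)) rho_th.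
(* Since [v_j^2 <= d la_j^2], weighting by [la_j^2 / v_j^2] loses at most a factor [d] of the
   energy. *)
have dB : (A * rho) ^+ 2 - r * a k ^+ 2 <= d * B.
  apply: (le_trans head); rewrite /B mulr_sumr; apply: ler_sum => j _.
  have [_ vla] := la_v j.
  have -> : d * (g j * (la j * th j - theta0 j * la j) ^+ 2) =
    (th j - theta0 j) ^+ 2 * (d * la j ^+ 2 / v j ^+ 2) by rewrite /g; ring.
  by rewrite ler_peMr ?sqr_ge0// ler_pdivlMr ?mul1r// exprn_gt0.
have B0 : 0 <= B by apply: sumr_ge0 => j _; rewrite mulr_ge0 ?sqr_ge0.
(* Acceptance means [S < tau], and [tau] lies below the lower-tail threshold by
   [lower_threshold_le]. *)
apply: le_trans (quad_stat_lower_tail eps_gt0 sigma_gt0 g0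
  (P_law _ _ th_ell2 la_inf) W0 WE L0).
apply: le_measure; rewrite ?inE.
- by rewrite -[X in measurable X]setTI; exact: phi_test.
- by rewrite -[X in measurable X]setTI; exact: measurable_fun_le.
move=> w /= /negbT; rewrite -ltNge => /ltW/le_trans; apply.
exact: lower_threshold_le (slack _ _ ak dB).
Qed.
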